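(* Let $k$ be an algebraically closed field and let $X$ be a variety over $k$. Every Radon measure $\mu\in\mathcal{M}(|X|)$ is of the form $$\mu=\sum_{i\geq 0}a_i\delta_{x_i}$$ where, for each $i$, $x_i\in X$ is a (scheme-theoretic) point, $\delta_{x_i}$ is the Dirac measure at $x_i$, and $a_i\geq 0$.
   Context: A variety is an irreducible, reduced, separated scheme of finite type over a field. $|X|$ denotes the underlying set of the scheme $X$ (all points, not only closed ones) endowed with the constructible topology, i.e. the topology generated by the constructible subsets of $X$; it is compact Hausdorff, and every constructible subset is open and closed in it. $\mathcal{M}(|X|)$ is the space of (positive) Radon measures on $|X|$. The sum is over a countable index set. *)

(* Defs.v *)
From HB Require Import structures.
From mathcomp Require Import all_boot all_order all_algebra generic_quotient.
From mathcomp Require Import ring.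
From mathcomp Require Import all_classical all_reals all_analysis.

Set Implicit Arguments.
Unset Strict Implicit.
Unset Printing Implicit Defensive.

Import Order.TTheory GRing.Theory Num.Theory.
Local Open Scope classical_set_scope.
Local Open Scope ring_scope.

Record opens (X : topologicalType) := Opens {
  pts :> set X;
  pts_open : open pts }.

Definition opensI (X : topologicalType) (U V : opens X) : opens X :=
  Opens (openI (pts_open U) (pts_open V)).

Record ringedSpace := RingedSpace {
  carrier :> topologicalType;
  sections : opens carrier -> comPzRingType;
  res : forall U V : opens carrier,
    V `<=` U -> {rmorphism sections U -> sections V};
  res_id : forall (U : opens carrier) (h : U `<=` U) (s : sections U),
    res h s = s;
  res_comp : forall (U V W : opens carrier) (hVU : V `<=` U) (hWV : W `<=` V)
    (hWU : W `<=` U) (s : sections U), res hWV (res hVU s) = res hWU s;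
  sheaf_axiom : forall (I : Type) (U : opens carrier) (V : I -> opens carrier)
    (hV : forall i, V i `<=` U), U `<=` \bigcup_i V i ->
    forall s : forall i, sections (V i),
    (forall i j, res (@subIsetl _ (V i) (V j) : opensI (V i) (V j) `<=` V i) (s i)
               = res (@subIsetr _ (V i) (V j) : opensI (V i) (V j) `<=` V j) (s j)) ->
    exists! t : sections U, forall i, res (hV i) t = s i }.

(* The germ of [s] at [x] is a unit of the stalk at [x], a stalk being the
   colimit of the sections over the open neighbourhoods of [x]. *)
Definition germ_unit (X : ringedSpace) (U : opens X) (s : sections U) (x : X) :=
  exists (V : opens X) (h : V `<=` U) (t : sections V),
    pts V x /\ res h s * t = 1.

(* All stalks are local rings: nonzero, and a sum of two non-units is a
   non-unit.  Two germs at [x] can be represented on a common neighbourhood. *)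
Definition locally_ringed (X : ringedSpace) :=
  forall (x : X) (U : opens X), pts U x ->
    (1 != 0 :> sections U) /\
    (forall s t : sections U,
      germ_unit (s + t) x -> germ_unit s x \/ germ_unit t x).

Definition preimO (X Y : topologicalType) (f : X -> Y)
    (fc : forall V : set Y, open V -> open (f @^-1` V)) (V : opens Y) : opens X :=
  Opens (fc V (pts_open V)).

Record ringedMap (X Y : ringedSpace) := RingedMap {
  on_pts :> X -> Y;
  on_pts_cont : forall V : set Y, open V -> open (on_pts @^-1` V);
  comap : forall V : opens Y,
    {rmorphism sections V -> sections (preimO on_pts_cont V)};
  comap_res : forall (V W : opens Y) (h : W `<=` V)
    (h' : preimO on_pts_cont W `<=` preimO on_pts_cont V) (s : sections V),
    comap W (res h s) = res h' (comap V s) }.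

(* The induced maps on stalks are local homomorphisms. *)
Definition local_map (X Y : ringedSpace) (f : ringedMap X Y) :=
  forall (x : X) (V : opens Y) (s : sections V), pts V (f x) ->
    germ_unit (comap f V s) x -> germ_unit s (f x).

(* An isomorphism of [X] onto the restriction of [Y] to an open subset. *)
Definition open_immersion (X Y : ringedSpace) (f : ringedMap X Y) :=
  [/\ injective f,
      forall U : set X, open U -> open (f @` U) &
      forall V : opens Y, V `<=` range f -> bijective (comap f V)].

Definition closed_immersion (X Y : ringedSpace) (f : ringedMap X Y) :=
  [/\ injective f,
      forall F : set X, closed F -> closed (f @` F) &
      forall (V : opens Y) (s : sections (preimO (@on_pts_cont _ _ f) V)) (y : Y),
        pts V y -> exists (W : opens Y) (hW : W `<=` V)
          (h : preimO (@on_pts_cont _ _ f) W `<=` preimO (@on_pts_cont _ _ f) V)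
          (t : sections W), pts W y /\ comap f W t = res h s].

Section Composition.

Definition ringed_id (X : ringedSpace) : ringedMap X X.
Proof.
refine (@RingedMap X X id (fun V hV => hV)
  (fun V => res (@subset_refl _ V : preimO (fun V hV => hV) V `<=` V)) _).
move=> V W h h' s.
by rewrite !(res_comp _ _ (h : preimO (fun V hV => hV) W `<=` V)).
Defined.

Definition ringed_comp (X Y Z : ringedSpace)
  (g : ringedMap Y Z) (f : ringedMap X Y) : ringedMap X Z.
Proof.
refine (@RingedMap X Z (g \o f)
  (fun V hV => @on_pts_cont _ _ f _ (@on_pts_cont _ _ g _ hV))
  (fun V => comap f (preimO (@on_pts_cont _ _ g) V) \o comap g V
     : {rmorphism _ -> _}) _).
move=> V W h h' s /=.
have h1 : preimO (@on_pts_cont _ _ g) W `<=` preimO (@on_pts_cont _ _ g) V.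
  by move=> y; apply: h.
by rewrite (comap_res h h1) (comap_res h1 h').
Defined.

Lemma germ_unit_comap (X Y : ringedSpace) (f : ringedMap X Y) (V : opens Y)
    (s : sections V) (x : X) : germ_unit s (f x) -> germ_unit (comap f V s) x.
Proof.
move=> [W [h [t [Wx st1]]]].
have h' : preimO (@on_pts_cont _ _ f) W `<=` preimO (@on_pts_cont _ _ f) V.
  by move=> y; apply: h.
exists (preimO (@on_pts_cont _ _ f) W), h', (comap f W t); split=> //.
by rewrite -(comap_res h) -rmorphM st1 rmorph1.
Qed.

Lemma ringed_id_local (X : ringedSpace) : local_map (ringed_id X).
Proof.
move=> x V s Vx [W [h [t [Wx st1]]]].
by exists W, h, t; split; rewrite // -st1 /= !(res_comp _ _ (h : W `<=` V)).
Qed.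

Lemma ringed_comp_local (X Y Z : ringedSpace)
  (g : ringedMap Y Z) (f : ringedMap X Y) :
  local_map g -> local_map f -> local_map (ringed_comp g f).
Proof. by move=> gl fl x V s Vx u; apply: gl => //; apply: fl. Qed.

End Composition.

(* The points of Spec A.  The zero ring, whose spectrum is empty, is not a
   [comNzRingType]; this does not matter for the notion of scheme, as affine
   open sets are only used as neighbourhoods of points. *)
Record primeSpec (A : comNzRingType) := PrimeSpec {
  prime_pred : A -> bool;
  prime_ideal : idealr_closed prime_pred;
  prime_prime : prime_idealr_closed prime_pred }.

Coercion prime_mem (A : comNzRingType) (p : primeSpec A) : {pred A} :=
  prime_pred p.

HB.instance Definition _ (A : comNzRingType) := gen_eqMixin (primeSpec A).
HB.instance Definition _ (A : comNzRingType) := gen_choiceMixin (primeSpec A).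

Section PrimeIdeal.
Variables (A : comNzRingType) (p : primeSpec A).

Lemma prime1 : 1 \notin p. Proof. by case: (prime_ideal p). Qed.

Lemma prime0 : 0 \in p. Proof. by case: (prime_ideal p). Qed.

Lemma primeD a b : a \in p -> b \in p -> a + b \in p.
Proof.
by case: (prime_ideal p) => _ _ h pa pb; rewrite -[a]mul1r; apply: h.
Qed.

Lemma primeMl a b : b \in p -> a * b \in p.
Proof.
by case: (prime_ideal p) => p0 _ h pb; rewrite -[_ * _]addr0; apply: h.
Qed.

Lemma primeM a b : a \notin p -> b \notin p -> a * b \notin p.
Proof.
move=> pa pb; apply/negP => /(@prime_prime _ p).
by rewrite (negbTE pa) (negbTE pb).
Qed.

Lemma prime_notin_l a b : a * b \notin p -> a \notin p.
Proof. by apply: contra => pa; rewrite mulrC primeMl. Qed.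

End PrimeIdeal.

Definition zeros (A : comNzRingType) (E : set A) : set (primeSpec A) :=
  [set p : primeSpec A | forall a, E a -> a \in p].

Section Zariski.
Variable A : comNzRingType.

Definition zariski_open : set (set (primeSpec A)) :=
  [set U | exists E : set A, U = ~` zeros E].

Lemma zariski_openT : zariski_open setT.
Proof.
exists [set 1]; rewrite -[LHS]setCK setCT; congr (~` _).
by apply/seteqP; split=> // p /(_ 1 erefl) p1; have := prime1 p; rewrite p1.
Qed.

Lemma zariski_openI : setI_closed zariski_open.
Proof.
move=> _ _ [E ->] [F ->]; exists [set a * b | a in E & b in F].
rewrite -setCU; congr (~` _); apply/seteqP; split=> p.
  by move=> [h|h] _ [a Ea [b Fb <-]]; [rewrite mulrC|]; apply/primeMl/h.
move=> h; apply/or_asboolP/negPn; rewrite negb_or; apply/andP => -[].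
move=> /asboolPn /existsNP[a /not_implyP[Ea /negP pa]].
move=> /asboolPn /existsNP[b /not_implyP[Fb /negP pb]].
have /negP := primeM pa pb; apply; apply: h.
by exists a => //; exists b.
Qed.

Lemma zariski_open_bigU (I : Type) (f : I -> set (primeSpec A)) :
  (forall i, zariski_open (f i)) -> zariski_open (\bigcup_i f i).
Proof.
move=> /choice[E fE]; exists (\bigcup_i E i).
apply/seteqP; split=> p.
  move=> [i _]; rewrite fE => h h'; apply: h => a Ea.
  by apply: h'; exists i.
move=> h; apply: contrapT => h'; apply: h => a [i _ Eia].
apply: contrapT => pa; apply: h'; exists i => //; rewrite fE => h.
by apply: pa; apply: h.
Qed.

HB.instance Definition _ := isOpenTopological.Build (primeSpec A)
  zariski_openT zariski_openI zariski_open_bigU.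

Lemma zariski_openE : @open (primeSpec A) = zariski_open.
Proof. by []. Qed.

Lemma basic_open (f : A) : open [set p : primeSpec A | f \notin p].
Proof.
exists [set f]; apply/seteqP; split=> p /=.
  by move=> /negP pf h; apply/pf/h.
by move=> h; apply/negP => pf; apply: h => _ ->.
Qed.

End Zariski.

(* The localization of [A] at the prime ideal [p]: a/s = b/t when
   u (a t - b s) = 0 for some u outside p. *)
Section Localization.
Local Open Scope quotient_scope.
Variables (A : comNzRingType) (p : primeSpec A).

Record fracs := Frac { num : A; den : A; den_notin : den \notin p }.

HB.instance Definition _ := gen_eqMixin fracs.
HB.instance Definition _ := gen_choiceMixin fracs.

Definition frac_eq (x y : fracs) : bool :=
  `[< exists2 u, u \notin p & u * (num x * den y - num y * den x) = 0 >].

Lemma frac_eq_refl : reflexive frac_eq.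
Proof.
by move=> x; apply/asboolP; exists 1; [exact: prime1|rewrite subrr mulr0].
Qed.

Lemma frac_eq_sym : symmetric frac_eq.
Proof.
suff h x y : frac_eq x y -> frac_eq y x by move=> x y; apply/idP/idP; apply: h.
move=> /asboolP[u pu e]; apply/asboolP; exists u => //.
by rewrite -opprB mulrN e oppr0.
Qed.

Lemma frac_eq_trans : transitive frac_eq.
Proof.
move=> y x z /asboolP[u pu e] /asboolP[v pv e']; apply/asboolP.
exists (u * v * den y); first by rewrite !primeM// den_notin.
have -> : u * v * den y * (num x * den z - num z * den x) =
  v * den z * (u * (num x * den y - num y * den x)) +
  u * den x * (v * (num y * den z - num z * den y)) by ring.
by rewrite e e' !mulr0 addr0.
Qed.

Canonical frac_equiv := EquivRel frac_eq frac_eq_refl frac_eq_sym frac_eq_trans.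

Definition local_at := {eq_quot frac_eq}.

HB.instance Definition _ : EqQuotient _ frac_eq local_at :=
  EqQuotient.on local_at.
HB.instance Definition _ := Choice.on local_at.

Definition frac (a s : A) (ps : s \notin p) : local_at := \pi_local_at (Frac a ps).

Lemma fracP (x : local_at) : exists a s (ps : s \notin p), x = frac a ps.
Proof.
by elim/quotW: x => -[a s ps]; exists a, s, ps.
Qed.

Lemma eq_frac a s (ps : s \notin p) b t (pt : t \notin p) :
  frac a ps = frac b pt <-> exists2 u, u \notin p & u * (a * t - b * s) = 0.
Proof.
split; first by move/eqP; rewrite /frac eqmodE => /asboolP.
by move=> h; apply/eqP; rewrite /frac eqmodE; apply/asboolP.
Qed.

Definition loc_add (x y : local_at) : local_at :=
  frac (num (repr x) * den (repr y) + num (repr y) * den (repr x))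
       (primeM (den_notin (repr x)) (den_notin (repr y))).
Definition loc_mul (x y : local_at) : local_at :=
  frac (num (repr x) * num (repr y))
       (primeM (den_notin (repr x)) (den_notin (repr y))).
Definition loc_opp (x : local_at) : local_at :=
  frac (- num (repr x)) (den_notin (repr x)).

Lemma frac_repr a s (ps : s \notin p) : exists2 u, u \notin p &
  u * (num (repr (frac a ps)) * s - a * den (repr (frac a ps))) = 0.
Proof.
apply/(eq_frac _ (den_notin _) _ ps); rewrite -[RHS]reprK /frac.
by congr (\pi_local_at _); case: (repr _).
Qed.

Lemma loc_addE a s (ps : s \notin p) b t (pt : t \notin p) :
  loc_add (frac a ps) (frac b pt) = frac (a * t + b * s) (primeM ps pt).
Proof.
have [u pu eu] := frac_repr a ps; have [v pv ev] := frac_repr b pt.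
apply/eq_frac; exists (u * v); first exact: primeM.
move: eu ev; set x := repr (frac a ps); set y := repr (frac b pt) => eu ev.
have -> : u * v * ((num x * den y + num y * den x) * (s * t) -
    (a * t + b * s) * (den x * den y)) =
  v * den y * t * (u * (num x * s - a * den x)) +
  u * den x * s * (v * (num y * t - b * den y)) by ring.
by rewrite eu ev !mulr0 addr0.
Qed.

Lemma loc_mulE a s (ps : s \notin p) b t (pt : t \notin p) :
  loc_mul (frac a ps) (frac b pt) = frac (a * b) (primeM ps pt).
Proof.
have [u pu eu] := frac_repr a ps; have [v pv ev] := frac_repr b pt.
apply/eq_frac; exists (u * v); first exact: primeM.
move: eu ev; set x := repr (frac a ps); set y := repr (frac b pt) => eu ev.
have -> : u * v * (num x * num y * (s * t) - a * b * (den x * den y)) =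
  v * num y * t * (u * (num x * s - a * den x)) +
  u * a * den x * (v * (num y * t - b * den y)) by ring.
by rewrite eu ev !mulr0 addr0.
Qed.

Lemma loc_oppE a s (ps : s \notin p) : loc_opp (frac a ps) = frac (- a) ps.
Proof.
have [u pu eu] := frac_repr a ps; apply/eq_frac; exists u => //.
set x := repr (frac a ps) in eu *.
have -> : u * (- num x * s - - a * den x) = - (u * (num x * s - a * den x)).
  by ring.
by rewrite eu oppr0.
Qed.

Lemma eq_frac_of a s (ps : s \notin p) b t (pt : t \notin p) :
  a * t = b * s -> frac a ps = frac b pt.
Proof.
by move=> e; apply/eq_frac; exists 1; rewrite ?prime1// e subrr mulr0.
Qed.

Let loc0 : local_at := frac 0 (prime1 p).
Let loc1 : local_at := frac 1 (prime1 p).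

Let loc_addA : associative loc_add.
Proof.
move=> x y z; have [a [s [ps ->]]] := fracP x.
have [b [t [pt ->]]] := fracP y; have [c [r [pr ->]]] := fracP z.
by rewrite !loc_addE; apply: eq_frac_of; ring.
Qed.

Let loc_addC : commutative loc_add.
Proof.
move=> x y; have [a [s [ps ->]]] := fracP x.
have [b [t [pt ->]]] := fracP y.
by rewrite !loc_addE; apply: eq_frac_of; ring.
Qed.

Let loc_add0 : left_id loc0 loc_add.
Proof.
move=> x; have [a [s [ps ->]]] := fracP x.
by rewrite !loc_addE; apply: eq_frac_of; ring.
Qed.

Let loc_addN : left_inverse loc0 loc_opp loc_add.
Proof.
move=> x; have [a [s [ps ->]]] := fracP x.
by rewrite loc_oppE loc_addE; apply: eq_frac_of; ring.
Qed.

Let loc_mulA : associative loc_mul.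
Proof.
move=> x y z; have [a [s [ps ->]]] := fracP x.
have [b [t [pt ->]]] := fracP y; have [c [r [pr ->]]] := fracP z.
by rewrite !loc_mulE; apply: eq_frac_of; ring.
Qed.

Let loc_mulC : commutative loc_mul.
Proof.
move=> x y; have [a [s [ps ->]]] := fracP x.
have [b [t [pt ->]]] := fracP y.
by rewrite !loc_mulE; apply: eq_frac_of; ring.
Qed.

Let loc_mul1 : left_id loc1 loc_mul.
Proof.
move=> x; have [a [s [ps ->]]] := fracP x.
by rewrite !loc_mulE; apply: eq_frac_of; ring.
Qed.

Let loc_mulDl : left_distributive loc_mul loc_add.
Proof.
move=> x y z; have [a [s [ps ->]]] := fracP x.
have [b [t [pt ->]]] := fracP y; have [c [r [pr ->]]] := fracP z.
by rewrite !(loc_mulE, loc_addE); apply: eq_frac_of; ring.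
Qed.

Let loc_1neq0 : loc1 != loc0.
Proof.
apply/eqP => /eq_frac[u pu]; rewrite mul1r mul0r subr0 mulr1 => u0.
by move: pu; rewrite u0 prime0.
Qed.

HB.instance Definition _ := GRing.isZmodule.Build local_at
  loc_addA loc_addC loc_add0 loc_addN.
HB.instance Definition _ := GRing.Zmodule_isComNzRing.Build local_at
  loc_mulA loc_mulC loc_mul1 loc_mulDl loc_1neq0.

Lemma frac_add a s (ps : s \notin p) b t (pt : t \notin p) :
  frac a ps + frac b pt = frac (a * t + b * s) (primeM ps pt).
Proof. exact: loc_addE. Qed.

Lemma frac_mul a s (ps : s \notin p) b t (pt : t \notin p) :
  frac a ps * frac b pt = frac (a * b) (primeM ps pt).
Proof. exact: loc_mulE. Qed.

Lemma frac_opp a s (ps : s \notin p) : - frac a ps = frac (- a) ps.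
Proof. exact: loc_oppE. Qed.

Lemma frac0 : 0 = frac 0 (prime1 p). Proof. by []. Qed.

Lemma frac1 : 1 = frac 1 (prime1 p). Proof. by []. Qed.

End Localization.
Arguments frac {A p} a {s} ps.

Section StructureSheaf.
Variable A : comNzRingType.
Implicit Types (U V W : opens (primeSpec A)).

Definition locally_frac U (s : forall p : primeSpec A, pts U p -> local_at p) :=
  forall p, pts U p -> exists V (a f : A),
    [/\ pts V p, V `<=` U &
        forall (q : primeSpec A) (Uq : pts U q), pts V q ->
          exists qf : f \notin q, s q Uq = frac a qf].

Record specSections U := SpecSections {
  value : forall p : primeSpec A, pts U p -> local_at p;
  value_frac : locally_frac value }.

HB.instance Definition _ U := gen_eqMixin (specSections U).
HB.instance Definition _ U := gen_choiceMixin (specSections U).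

Lemma specSectionsP U (s t : specSections U) :
  (forall p Up, value s (p := p) Up = value t Up) -> s = t.
Proof.
case: s t => [s hs] [t ht] /= e.
have {}e : s = t by apply: functional_extensionality_dep => p; apply/funext => Up.
by rewrite e in hs *; congr SpecSections; exact: Prop_irrelevance.
Qed.

Lemma locally_frac_const U (a : A) :
  locally_frac (fun (p : primeSpec A) (_ : pts U p) => frac a (prime1 p)).
Proof.
by move=> p Up; exists U, a, 1; split=> // q Uq _; exists (prime1 q).
Qed.

Lemma locally_frac_add U (s t : specSections U) :
  locally_frac (fun (p : primeSpec A) (Up : pts U p) => value s Up + value t Up).
Proof.
move=> p Up; have [V [a [f [Vp VU hV]]]] := value_frac s Up.
have [W [b [g [Wp WU hW]]]] := value_frac t Up.
exists (opensI V W), (a * g + b * f), (f * g); split=> //.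
  by move=> q [/VU].
move=> q Uq [Vq Wq]; have [qf ->] := hV q Uq Vq; have [qg ->] := hW q Uq Wq.
by exists (primeM qf qg); rewrite frac_add.
Qed.

Lemma locally_frac_mul U (s t : specSections U) :
  locally_frac (fun (p : primeSpec A) (Up : pts U p) => value s Up * value t Up).
Proof.
move=> p Up; have [V [a [f [Vp VU hV]]]] := value_frac s Up.
have [W [b [g [Wp WU hW]]]] := value_frac t Up.
exists (opensI V W), (a * b), (f * g); split=> //.
  by move=> q [/VU].
move=> q Uq [Vq Wq]; have [qf ->] := hV q Uq Vq; have [qg ->] := hW q Uq Wq.
by exists (primeM qf qg); rewrite frac_mul.
Qed.

Lemma locally_frac_opp U (s : specSections U) :
  locally_frac (fun (p : primeSpec A) (Up : pts U p) => - value s Up).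
Proof.
move=> p Up; have [V [a [f [Vp VU hV]]]] := value_frac s Up.
exists V, (- a), f; split=> // q Uq Vq.
by have [qf ->] := hV q Uq Vq; exists qf; rewrite frac_opp.
Qed.

Definition spec_const U (a : A) : specSections U :=
  SpecSections (@locally_frac_const U a).
Definition spec_add U (s t : specSections U) :=
  SpecSections (locally_frac_add s t).
Definition spec_mul U (s t : specSections U) :=
  SpecSections (locally_frac_mul s t).
Definition spec_opp U (s : specSections U) :=
  SpecSections (locally_frac_opp s).

Section Ring.
Variable U : opens (primeSpec A).

Let addA : associative (@spec_add U).
Proof. by move=> s t r; apply: specSectionsP => p Up; exact: addrA. Qed.

Let addC : commutative (@spec_add U).
Proof. by move=> s t; apply: specSectionsP => p Up; exact: addrC. Qed.

Let add0 : left_id (spec_const U 0) (@spec_add U).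
Proof. by move=> s; apply: specSectionsP => p Up; exact: add0r. Qed.

Let addN : left_inverse (spec_const U 0) (@spec_opp U) (@spec_add U).
Proof. by move=> s; apply: specSectionsP => p Up; exact: addNr. Qed.

Let mulA : associative (@spec_mul U).
Proof. by move=> s t r; apply: specSectionsP => p Up; exact: mulrA. Qed.

Let mulC : commutative (@spec_mul U).
Proof. by move=> s t; apply: specSectionsP => p Up; exact: mulrC. Qed.

Let mul1 : left_id (spec_const U 1) (@spec_mul U).
Proof. by move=> s; apply: specSectionsP => p Up; exact: mul1r. Qed.

Let mulDl : left_distributive (@spec_mul U) (@spec_add U).
Proof. by move=> s t r; apply: specSectionsP => p Up; exact: mulrDl. Qed.

HB.instance Definition _ := GRing.isZmodule.Build (specSections U)
  addA addC add0 addN.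
HB.instance Definition _ := GRing.Zmodule_isComPzRing.Build (specSections U)
  mulA mulC mul1 mulDl.

End Ring.

Lemma locally_frac_res U V (h : V `<=` U) (s : specSections U) :
  locally_frac (fun (p : primeSpec A) (Vp : pts V p) => value s (h p Vp)).
Proof.
move=> p Vp; have [W [a [f [Wp WU hW]]]] := value_frac s (h p Vp).
by exists (opensI W V), a, f; split=> [//|q []//|q Vq [Wq _]]; exact: hW.
Qed.

Definition spec_res U V (h : V `<=` U) (s : specSections U) : specSections V :=
  SpecSections (locally_frac_res h s).

Lemma spec_res_zmod U V (h : V `<=` U) : zmod_morphism (spec_res h).
Proof. by move=> s t; apply: specSectionsP. Qed.

Lemma spec_res_monoid U V (h : V `<=` U) : monoid_morphism (spec_res h).
Proof. by split=> [|s t]; apply: specSectionsP. Qed.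

HB.instance Definition _ U V (h : V `<=` U) :=
  GRing.isZmodMorphism.Build _ _ (spec_res h) (spec_res_zmod h).
HB.instance Definition _ U V (h : V `<=` U) :=
  GRing.isMonoidMorphism.Build _ _ (spec_res h) (spec_res_monoid h).

Lemma spec_res_id U (h : U `<=` U) (s : specSections U) : spec_res h s = s.
Proof.
apply: specSectionsP => p Up /=; congr (value s _); exact: Prop_irrelevance.
Qed.

Lemma spec_res_comp U V W (hVU : V `<=` U) (hWV : W `<=` V) (hWU : W `<=` U)
  (s : specSections U) : spec_res hWV (spec_res hVU s) = spec_res hWU s.
Proof.
apply: specSectionsP => p Wp /=; congr (value s _); exact: Prop_irrelevance.
Qed.

Lemma spec_sheaf (I : Type) U (V : I -> opens (primeSpec A))
    (hV : forall i, V i `<=` U) : U `<=` \bigcup_i V i ->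
  forall s : forall i, specSections (V i),
  (forall i j,
     spec_res (@subIsetl _ (V i) (V j) : opensI (V i) (V j) `<=` V i) (s i) =
     spec_res (@subIsetr _ (V i) (V j) : opensI (V i) (V j) `<=` V j) (s j)) ->
  exists! t : specSections U, forall i, spec_res (hV i) t = s i.
Proof.
move=> cov s compat.
have /choice[k kP] : forall q : {p | pts U p}, exists i, pts (V i) (sval q).
  by move=> [q Uq] /=; have [i _ Viq] := cov q Uq; exists i.
pose v (p : primeSpec A) (Up : pts U p) : local_at p :=
  value (s _) (kP (exist _ p Up)).
have vE p (Up : pts U p) i (Vip : pts (V i) p) : v p Up = value (s i) Vip.
  set j := k (exist _ p Up).
  have := congr1 (fun r : specSections (opensI (V j) (V i)) =>
    value r (conj (kP (exist _ p Up)) Vip : pts (opensI (V j) (V i)) p))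
    (compat j i).
  rewrite /v /= => e; apply: etrans (etrans e _);
    congr value; exact: Prop_irrelevance.
have vfrac : locally_frac v.
  move=> p Up; have [i _ Vip] := cov p Up.
  have [W [a [f [Wp WV hW]]]] := value_frac (s i) Vip.
  exists W, a, f; split=> // [q /WV|q Uq Wq]; first exact: hV.
  by rewrite (vE q Uq i (WV q Wq)); exact: hW.
exists (SpecSections vfrac); split=> [i|t ht].
  by apply: specSectionsP => p Vip /=; exact: vE.
apply: specSectionsP => p Up /=; have [i _ Vip] := cov p Up.
rewrite (vE p Up i Vip) -ht /=; congr value; exact: Prop_irrelevance.
Qed.

Definition spec_ringed : ringedSpace :=
  @RingedSpace (primeSpec A) (fun U => specSections U)
    (fun U V h => spec_res h : {rmorphism _ -> _})
    spec_res_id spec_res_comp spec_sheaf.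

End StructureSheaf.

Definition affine_open (X : ringedSpace) (U : set X) :=
  exists (A : comNzRingType) (j : ringedMap (spec_ringed A) X),
    open_immersion j /\ range j = U.

Record scheme := Scheme {
  scheme_space :> ringedSpace;
  scheme_locally_ringed : locally_ringed scheme_space;
  scheme_affine_nbhs : forall x : scheme_space,
    exists U : set scheme_space, affine_open U /\ U x }.

Section SpecScheme.
Variable A : comNzRingType.

Lemma spec_value_unit (U : opens (primeSpec A)) (s : specSections U)
    (p : primeSpec A) (Up : pts U p) (r : local_at p) :
  value s Up * r = 1 -> @germ_unit (spec_ringed A) U s p.
Proof.
move=> sr1; have [V [a [f [Vp VU hV]]]] := value_frac s Up.
have [pf sE] := hV p Up Vp.
have pa : a \notin p.
  apply/negP => pa; have [b [g [pg rE]]] := fracP r.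
  move: sr1; rewrite sE rE frac_mul frac1 => /eq_frac[u pu /eqP].
  rewrite mulr1 mul1r mulrBr subr_eq0 => /eqP e.
  have /negP := primeM pu (primeM pf pg); apply.
  by rewrite -e [a * b]mulrC mulrA primeMl.
pose W := opensI V (Opens (basic_open a)).
have WU : W `<=` U by move=> q [/VU].
have tfrac : locally_frac (U := W)
    (fun q (Wq : pts W q) => frac f (proj2 Wq : a \notin q)).
  move=> q Wq; exists W, f, a; split=> // q' Wq' _.
  by exists (proj2 Wq').
exists W, WU, (SpecSections tfrac); split=> //.
apply: specSectionsP => q [Vq qa] /=.
have [qf sqE] := hV q (WU q (conj Vq qa)) Vq.
transitivity (value s (WU q (conj Vq qa)) * frac f qa).
  by congr (_ * frac f _); exact: Prop_irrelevance.
rewrite sqE frac_mul; transitivity (frac 1 (prime1 q)); last by [].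
by apply: eq_frac_of; ring.
Qed.

Lemma spec_germ_unit (U : opens (primeSpec A)) (s : specSections U)
    (p : primeSpec A) (Up : pts U p) :
  @germ_unit (spec_ringed A) U s p -> exists r, value s Up * r = 1.
Proof.
move=> [V [h [t [Vp st1]]]]; exists (value t Vp).
have := congr1 (fun r : specSections V => value r Vp) st1.
move=> /= e; apply: etrans e; congr (value s _ * _); exact: Prop_irrelevance.
Qed.

Lemma local_at_local (p : primeSpec A) (x y r : local_at p) :
  (x + y) * r = 1 -> (exists r', x * r' = 1) \/ (exists r', y * r' = 1).
Proof.
have inv a s (ps : s \notin p) : a \notin p -> exists r', frac a ps * r' = 1.
  move=> pa; exists (frac s pa); rewrite frac_mul frac1.
  by apply: eq_frac_of; ring.
have [a [s [ps ->]]] := fracP x; have [b [t [pt ->]]] := fracP y.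
have [c [g [pg ->]]] := fracP r.
have [pa|pa] := boolP (a \in p); last by left; exact: inv.
have [pb|pb] := boolP (b \in p); last by right; exact: inv.
rewrite frac_add frac_mul frac1 => /eq_frac[u pu /eqP].
rewrite mulr1 mul1r mulrBr subr_eq0 => /eqP e; exfalso.
have /negP := primeM pu (primeM (primeM ps pt) pg); apply.
rewrite -e; apply: primeMl; rewrite mulrC; apply: primeMl.
by apply: primeD; rewrite mulrC; apply: primeMl.
Qed.

Lemma spec_locally_ringed : locally_ringed (spec_ringed A).
Proof.
move=> p U Up; split.
  apply/eqP => e; have := congr1 (fun r : specSections U => value r Up) e.
  by move=> /eqP; apply/negP; exact: oner_neq0.
move=> s t /(spec_germ_unit Up)[r]; rewrite /= => /local_at_local[] [r' e].
  by left; exact: spec_value_unit e.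
by right; exact: spec_value_unit e.
Qed.

Lemma ringed_id_open_immersion (X : ringedSpace) :
  open_immersion (ringed_id X).
Proof.
split=> // [U oU|V _]; first by rewrite image_id.
set V' := preimO _ V.
exists (res (@subset_refl _ V : V `<=` V')) => s /=.
  by rewrite (res_comp _ _ (@subset_refl _ V)) res_id.
by rewrite (res_comp _ _ (@subset_refl _ V : V' `<=` V')) res_id.
Qed.

Lemma spec_affine_nbhs (p : spec_ringed A) :
  exists U : set (spec_ringed A), affine_open U /\ U p.
Proof.
exists setT; split=> //; exists A, (ringed_id _); split.
  exact: ringed_id_open_immersion.
by rewrite -[RHS]image_id.
Qed.

Definition Spec : scheme := Scheme spec_locally_ringed spec_affine_nbhs.

End SpecScheme.

Record schemeMap (X Y : scheme) := SchemeMap {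
  scheme_map :> ringedMap X Y;
  scheme_map_local : local_map scheme_map }.

Definition scheme_id (X : scheme) : schemeMap X X :=
  SchemeMap (@ringed_id_local X).

Definition scheme_comp (X Y Z : scheme) (g : schemeMap Y Z)
    (f : schemeMap X Y) : schemeMap X Z :=
  SchemeMap (ringed_comp_local (@scheme_map_local _ _ g)
                               (@scheme_map_local _ _ f)).

Definition is_fiber_product (X Y S P : scheme)
    (f : schemeMap X S) (g : schemeMap Y S)
    (p1 : schemeMap P X) (p2 : schemeMap P Y) :=
  scheme_comp f p1 = scheme_comp g p2 /\
  forall (T : scheme) (a : schemeMap T X) (b : schemeMap T Y),
    scheme_comp f a = scheme_comp g b ->
    exists! c : schemeMap T P, scheme_comp p1 c = a /\ scheme_comp p2 c = b.

(* Fiber products of schemes exist and are unique up to isomorphism, so it does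
   not matter which one is used. *)
Definition separated (X S : scheme) (f : schemeMap X S) :=
  forall (P : scheme) (p1 p2 : schemeMap P X) (delta : schemeMap X P),
    is_fiber_product f f p1 p2 ->
    scheme_comp p1 delta = scheme_id X -> scheme_comp p2 delta = scheme_id X ->
    closed_immersion delta.

(* [B] is generated by finitely many elements as an algebra over [A]. *)
Definition finite_type_hom (A B : comPzRingType) (phi : {rmorphism A -> B}) :=
  exists bs : seq B, forall S : {pred B}, GRing.subring_closed S ->
    (forall a, phi a \in S) -> (forall b, b \in bs -> b \in S) ->
    forall b, b \in S.

Definition locally_of_finite_type (X S : scheme) (f : schemeMap X S) :=
  forall x : X, exists (U : opens X) (V : opens S)
      (h : U `<=` preimO (@on_pts_cont _ _ f) V),
    [/\ pts U x, affine_open U, affine_open V &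
        finite_type_hom (res h \o comap f V : {rmorphism _ -> _})].

Definition quasi_compact_map (X S : scheme) (f : schemeMap X S) :=
  forall V : set S, open V -> compact V -> compact (f @^-1` V).

Definition finite_type (X S : scheme) (f : schemeMap X S) :=
  locally_of_finite_type f /\ quasi_compact_map f.

Definition irreducible_space (X : topologicalType) :=
  [set: X] !=set0 /\
  forall F G : set X, closed F -> closed G -> F `|` G = setT ->
    F = setT \/ G = setT.

Definition reduced (X : scheme) :=
  forall (U : opens X) (s : sections U) (n : nat), s ^+ n = 0 -> s = 0.

Record variety (k : fieldType) := Variety {
  variety_scheme :> scheme;
  variety_map : schemeMap variety_scheme (Spec k);
  variety_irreducible : irreducible_space variety_scheme;
  variety_reduced : reduced variety_scheme;
  variety_separated : separated variety_map;
  variety_finite_type : finite_type variety_map }.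

(* In a noetherian space, such as a variety, every open subset is retrocompact,
   so that this is the general notion of constructible subset. *)
Inductive constructible (X : topologicalType) : set X -> Prop :=
| constructible_open (U : set X) : open U -> constructible U
| constructibleC (C : set X) : constructible C -> constructible (~` C)
| constructibleI (C D : set X) :
    constructible C -> constructible D -> constructible (C `&` D).

(* The set of points of [X] with the constructible topology. *)
Definition abs_space (k : fieldType) (X : variety k) : Type := X.

Section AbsSpace.
Variables (k : fieldType) (X : variety k).

HB.instance Definition _ := Choice.on (abs_space X).
(* Only needed because measurable types are pointed in the library. *)
HB.instance Definition _ := isPointed.Build (abs_space X)
  (sval (cid (proj1 (variety_irreducible X)))).
HB.instance Definition _ := @isSubBaseTopological.Build (abs_space X)
  (set X) (@constructible X) id.

End AbsSpace.

Definition borel (T : ptopologicalType) := g_sigma_algebraType (@open T).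

Definition radon (R : realType) (T : ptopologicalType)
    (mu : {measure set (borel T) -> \bar R}) :=
  [/\ forall K : set T, compact K -> (mu K < +oo)%E,
      forall B : set (borel T), measurable B ->
        mu B = ereal_inf [set mu U | U in [set U : set T | open U /\ B `<=` U]] &
      forall U : set T, open U ->
        mu U = ereal_sup [set mu K | K in [set K : set T | compact K /\ K `<=` U]]].

(* Main.v *)
(* A variety is a noetherian space in which irreducible closed sets have generic
   points, and its constructible topology is compact Hausdorff, so [mu] is finite.
   By noetherian induction, [mu] is carried on each Zariski closed [Z] by a
   countable set.  If [Z] is irreducible with generic point [x], a compact subset
   of [Z \ x] lies in a proper Zariski closed subset of [Z]; by inner regularity,
   [Z \ x] is, up to a null set, a countable union of such subsets, to which the
   induction hypothesis applies.  Hence [mu] is the sum of its atoms. *)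

Require Import Defs.
From HB Require Import structures.
From mathcomp Require Import all_boot all_order all_algebra.
From mathcomp Require Import all_classical all_reals all_analysis.
From mathcomp Require Import ring.

Set Implicit Arguments.
Unset Strict Implicit.
Unset Printing Implicit Defensive.

Import Order.TTheory GRing.Theory Num.Theory.
Local Open Scope classical_set_scope.
Local Open Scope ring_scope.

(** * Hilbert's basis theorem *)

Section HilbertBasis.
Variable B : comPzRingType.
Implicit Types (S I : set B) (b : B).

(** Subrings and their ideals are subsets of one ambient ring [B], so a finitely generated
    subalgebra grows inside [B] without polynomial rings or quotients. *)
Definition is_subring S :=
  [/\ S 1, forall x y, S x -> S y -> S (x - y)
    & forall x y, S x -> S y -> S (x * y)].

Definition ideal_of S I :=
  [/\ I `<=` S, I 0, forall x y, I x -> I y -> I (x - y)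
    & forall s x, S s -> I x -> I (s * x)].

Definition noetherian_subring S :=
  forall I : nat -> set B, (forall n, ideal_of S (I n)) ->
  (forall n, I n `<=` I n.+1) ->
  exists N, forall n, (N <= n)%N -> I n `<=` I N.

Lemma homo_nat_subset (T : Type) (F : nat -> set T) :
  (forall n, F n `<=` F n.+1) -> forall m n, (m <= n)%N -> F m `<=` F n.
Proof. by move=> h; apply: homo_leq => // [A|A C D]; [|exact: subset_trans]. Qed.

Lemma subring0 S : is_subring S -> S 0.
Proof. by case=> S1 SB _; rewrite -(subrr 1); apply: SB. Qed.

(* Leading term first, as the Hilbert basis argument peels it off. *)
Fixpoint poly_values S b n : set B :=
  if n is m.+1 then
    [set x | exists s y, [/\ S s, poly_values S b m y & x = s * b ^+ m + y]]
  else [set 0].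

Definition adjoin S b : set B := \bigcup_n poly_values S b n.

Section Adjoin.
Variables (S : set B) (b : B).
Hypothesis rS : is_subring S.
Local Notation P := (poly_values S b).

Let S0 : S 0. Proof. exact: subring0. Qed.
Let S1 : S 1. Proof. by case: rS. Qed.
Let SB x y : S x -> S y -> S (x - y). Proof. by case: rS => _ + _; apply. Qed.
Let SM x y : S x -> S y -> S (x * y). Proof. by case: rS => _ _; apply. Qed.

Lemma poly_values0 n : P n 0.
Proof. by elim: n => //= n IH; exists 0, 0; rewrite mul0r addr0. Qed.

Lemma poly_valuesS n : P n `<=` P n.+1.
Proof. by move=> x Px; exists 0, x; rewrite mul0r add0r. Qed.

Lemma poly_valuesB n x y : P n x -> P n y -> P n (x - y).
Proof.
elim: n x y => [|n IH] x y /=; first by move=> -> ->; rewrite subrr.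
move=> [s [x' [Ss Px ->]]] [t [y' [St Py ->]]].
by exists (s - t), (x' - y'); split; [exact: SB|exact: IH|ring].
Qed.

Lemma poly_valuesZ n s x : S s -> P n x -> P n (s * x).
Proof.
move=> Ss; elim: n x => [|n IH] x /=; first by move=> ->; rewrite mulr0.
move=> [t [y [St Py ->]]].
by exists (s * t), (s * y); split; [exact: SM|exact: IH|ring].
Qed.

Lemma poly_valuesX n x : P n x -> P n.+1 (b * x).
Proof.
elim: n x => [|n IH] x; first by move=> ->; rewrite mulr0; exact: poly_values0.
move=> [s [y [Ss Py ->]]].
by exists s, (b * y); split; [by []|exact: IH|rewrite exprS; ring].
Qed.

Lemma adjoinB x y : adjoin S b x -> adjoin S b y -> adjoin S b (x - y).
Proof.
move=> [m _ Px] [n _ Py]; exists (maxn m n) => //.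
have mono := homo_nat_subset poly_valuesS.
by apply: poly_valuesB; [apply: (mono m) | apply: (mono n)];
  rewrite ?leq_maxl ?leq_maxr.
Qed.

Lemma adjoin0 : adjoin S b 0. Proof. by exists 0%N. Qed.

Lemma sub_adjoin : S `<=` adjoin S b.
Proof.
by move=> s Ss; exists 1%N => //; exists s, 0; rewrite expr0 mulr1 addr0.
Qed.

Lemma adjoinXn m x : adjoin S b x -> adjoin S b (b ^+ m * x).
Proof.
elim: m => [|m IH] h; first by rewrite mul1r.
by have [n _ /poly_valuesX h'] := IH h; exists n.+1; rewrite // exprS -mulrA.
Qed.

Lemma mem_adjoin : adjoin S b b.
Proof. by have := adjoinXn 1 (sub_adjoin S1); rewrite expr1 mulr1. Qed.

Lemma adjoinZ s x : S s -> adjoin S b x -> adjoin S b (s * x).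
Proof. by move=> Ss [n _ h]; exists n => //; exact: poly_valuesZ. Qed.

Lemma adjoinM x y : adjoin S b x -> adjoin S b y -> adjoin S b (x * y).
Proof.
move=> [m _ Px] By; elim: m x Px => [_ ->|m IH x [s [x' [Ss Px ->]]]].
  by rewrite mul0r; exact: adjoin0.
have -> : (s * b ^+ m + x') * y = s * (b ^+ m * y) - (0 - x' * y) by ring.
apply: adjoinB; first exact/adjoinZ/adjoinXn.
by apply: adjoinB; [exact: adjoin0|exact: IH].
Qed.

Lemma adjoin_subring : is_subring (adjoin S b).
Proof.
by split; [exact: sub_adjoin|move=> *; exact: adjoinB|move=> *; exact: adjoinM].
Qed.

(** As [b] may satisfy relations over [S], one element can have several expressions; each of formal
    degree at most [n] contributes its coefficient of [b ^+ n], zero included. *)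
Definition lead_coefs (I : set B) n : set B :=
  [set s | S s /\ exists2 y, P n y & I (s * b ^+ n + y)].

Lemma lead_coefs_ideal I n : ideal_of (adjoin S b) I -> ideal_of S (lead_coefs I n).
Proof.
case=> _ I0 IB IM; split=> [s []//| |x y|s x].
- by split=> //; exists 0; rewrite ?mul0r ?addr0//; exact: poly_values0.
- move=> [Sx [x' Px Ix]] [Sy [y' Py Iy]]; split; first exact: SB.
  exists (x' - y'); first exact: poly_valuesB.
  suff -> : (x - y) * b ^+ n + (x' - y') =
    x * b ^+ n + x' - (y * b ^+ n + y') by exact: IB.
  by ring.
- move=> Ss [Sx [x' Px Ix]]; split; first exact: SM.
  exists (s * x'); first exact: poly_valuesZ.
  by rewrite -mulrA -mulrDr; apply: IM => //; exact: sub_adjoin.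
Qed.

Lemma lead_coefsS I n : ideal_of (adjoin S b) I ->
  lead_coefs I n `<=` lead_coefs I n.+1.
Proof.
move=> [_ _ _ IM] s [Ss [y Py Iy]]; split=> //.
exists (b * y); first exact: poly_valuesX.
have -> : s * b ^+ n.+1 + b * y = b * (s * b ^+ n + y) by rewrite exprS; ring.
by apply: IM => //; exact: mem_adjoin.
Qed.

Lemma sub_lead_coefs I J n : I `<=` J -> lead_coefs I n `<=` lead_coefs J n.
Proof. by move=> IJ s [Ss [y Py Iy]]; split=> //; exists y => //; exact: IJ. Qed.

(** Subtracting from an element of [J] an element of [I] with the same leading coefficient leaves an
    element of [J] of smaller formal degree, to which induction applies. *)
Lemma eq_lead_coefs I J : ideal_of (adjoin S b) I -> ideal_of (adjoin S b) J ->
  I `<=` J -> (forall n, lead_coefs J n `<=` lead_coefs I n) -> J `<=` I.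
Proof.
move=> [_ I0 IB _] [JS J0 JB _] IJ h x Jx; have [n _ Px] := JS _ Jx.
elim: n x Px Jx => [x ->//|n IH x Px Jx].
case: Px Jx => s [y [Ss Py ->]] Jx.
have [|_ [z Pz Iz]] := h n s; first by split=> //; exists y.
(* The double subtraction encodes a sum, ideals being closed under differences by definition. *)
have -> : s * b ^+ n + y = (s * b ^+ n + z) - (0 - (y - z)) by ring.
apply: (IB) => //; apply: (IB) => //; apply: IH; first exact: poly_valuesB.
have -> : y - z = (s * b ^+ n + y) - (s * b ^+ n + z) by ring.
by apply: JB => //; exact: IJ.
Qed.

(** The diagonal chain [lead_coefs (I n) n] stabilizes at some [N], which settles all degrees from
    [N] on; the finitely many degrees below [N] are handled by one chain each. *)
Theorem noetherian_adjoin :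
  noetherian_subring S -> noetherian_subring (adjoin S b).
Proof.
move=> nS I idI incI.
have monoI := homo_nat_subset incI.
have monoL k := homo_nat_subset (fun n => @lead_coefsS (I k) n (idI k)).
have [N hN] : exists N, forall n, (N <= n)%N ->
    lead_coefs (I n) n `<=` lead_coefs (I N) N.
  apply: (nS (fun n => lead_coefs (I n) n)) => n; first exact: lead_coefs_ideal.
  by apply: subset_trans (@lead_coefsS _ _ _) _ => //; exact: sub_lead_coefs.
have /choice[M hM] : forall n, exists M, forall m, (M <= m)%N ->
    lead_coefs (I m) n `<=` lead_coefs (I M) n.
  move=> n; apply: (nS (fun m => lead_coefs (I m) n)) => m.
    exact: lead_coefs_ideal.
  exact: sub_lead_coefs.
pose K := maxn N (\max_(i < N) M i); exists K => k Kk.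
apply: eq_lead_coefs => //; first exact: monoI.
move=> n; have [Nn|nN] := leqP N n.
  (* Index and degree are raised to [maxn k n] to reach the diagonal, which lies in its term at [N];
     then the degree is raised from [N] to [n]. *)
  apply: (subset_trans (@sub_lead_coefs _ (I (maxn k n)) n _)).
    by apply: monoI; exact: leq_maxl.
  apply: (subset_trans (monoL _ _ _ (leq_maxr k n))).
  apply: (subset_trans (hN _ _)); first by rewrite (leq_trans Nn)// leq_maxr.
  apply: (subset_trans (monoL _ _ _ Nn)).
  by apply/sub_lead_coefs/monoI; exact: leq_maxl.
have MK : (M n <= K)%N.
  apply: leq_trans (leq_maxr _ _).
  exact: (@leq_bigmax _ (fun i : 'I_N => M i) (Ordinal nN)).
apply: (subset_trans (hM n _ (leq_trans MK Kk))).
exact/sub_lead_coefs/monoI.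
Qed.

End Adjoin.

Lemma noetherian_adjoin_seq S (bs : seq B) :
  is_subring S -> noetherian_subring S ->
  exists T, [/\ is_subring T, noetherian_subring T, S `<=` T
    & forall b, b \in bs -> T b].
Proof.
move=> rS nS; elim: bs => [|b bs [T [rT nT ST bsT]]]; first by exists S; split.
exists (adjoin T b); split; first exact: adjoin_subring.
- exact: noetherian_adjoin.
- by move=> x Sx; apply/sub_adjoin/ST.
- move=> c; rewrite inE => /predU1P[->|/bsT Tc]; first exact: mem_adjoin.
  exact: sub_adjoin.
Qed.

End HilbertBasis.

(** * Noetherian rings *)

Definition noetherian (B : comPzRingType) := noetherian_subring [set: B].

Lemma noetherian_surj (B C : comPzRingType) (f : {rmorphism B -> C}) :
  (forall c, exists b, f b = c) -> noetherian B -> noetherian C.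
Proof.
move=> /choice[g gK] nB I idI incI.
have [n|n x /=|N hN] := nB (fun n => f @^-1` I n).
- have [_ I0 IB IM] := idI n; split=> //= [|x y|s x _].
  + by rewrite rmorph0.
  + by rewrite rmorphB; exact: IB.
  + by rewrite rmorphM; exact: IM.
- exact: incI.
by exists N => n Nn c; rewrite -(gK c); apply: hN.
Qed.

Lemma finite_type_noetherian (A B : comPzRingType) (phi : {rmorphism A -> B}) :
  (forall a : A, a = 0 \/ exists a', a * a' = 1) ->
  finite_type_hom phi -> noetherian B.
Proof.
move=> fieldA [bs gen].
have rphi : is_subring (range phi).
  split; first by exists 1; rewrite ?rmorph1.
    by move=> _ _ [x _ <-] [y _ <-]; exists (x - y); rewrite ?rmorphB.
  by move=> _ _ [x _ <-] [y _ <-]; exists (x * y); rewrite ?rmorphM.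
have nphi : noetherian_subring (range phi).
  (* Either some [I N] contains 1 and is all of [range phi], or every [I n] is zero. *)
  move=> I idI incI; have [[N hN]|h] := pselect (exists N, I N 1).
    exists N => n _ x Ix; have [/(_ x Ix) [a _ <-] _ _ _] := idI n.
    by have [_ _ _ IM] := idI N; rewrite -[phi a]mulr1; apply: IM => //; exists a.
  exists 0%N => n _ x Ix; have [/(_ x Ix) [a _ ax] _ _ IM] := idI n.
  have [_ I0 _ _] := idI 0%N.
  have [a0|[a' aa']] := fieldA a; first by rewrite -ax a0 rmorph0.
  exfalso; apply: h; exists n; rewrite -(rmorph1 phi) -aa' rmorphM mulrC ax.
  by apply: IM => //; exists a'.
have [T [rT nT phiT bsT]] := noetherian_adjoin_seq bs rphi nphi.
rewrite /noetherian; suff -> : [set: B] = T by [].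
apply/seteqP; split=> // x _.
pose U : {pred B} := fun y => `[< T y >].
have UP y : reflect (T y) (y \in U) by apply: (iffP (asboolP _)).
case: rT => T1 TB TM; apply/UP; apply: gen => [|a|c cbs].
- split; first exact/UP.
  + by move=> y z /UP Ty /UP Tz; apply/UP; exact: TB.
  + by move=> y z /UP Ty /UP Tz; apply/UP; exact: TM.
- by apply/UP/phiT; exists a.
- by apply/UP/bsT.
Qed.

(** * Spectra *)

Definition noetherian_space (X : topologicalType) :=
  forall Z : nat -> set X, (forall n, closed (Z n)) ->
  (forall n, Z n.+1 `<=` Z n) -> exists N, forall n, (N <= n)%N -> Z N `<=` Z n.

Definition irreducible_set (X : topologicalType) (Z : set X) :=
  Z !=set0 /\ forall F G : set X, closed F -> closed G -> Z `<=` F `|` G ->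
    Z `<=` F \/ Z `<=` G.

(** The second clause says that [Z] lies in the closure of [x]. *)
Definition generic_point (X : topologicalType) (Z : set X) (x : X) :=
  Z x /\ forall U, open U -> U `&` Z !=set0 -> U x.

Section Spectrum.
Variable A : comNzRingType.
Implicit Types (p : primeSpec A) (U : opens (primeSpec A)) (Z : set (primeSpec A)).

Lemma frac_unit p a s (ps : s \notin p) :
  (exists r, Defs.frac a ps * r = 1) <-> a \notin p.
Proof.
split=> [[r]|pa].
  have [b [g [pg ->]]] := fracP r.
  rewrite frac_mul frac1 => /eq_frac[u pu /eqP].
  rewrite mulr1 mul1r mulrBr subr_eq0 => /eqP e; apply/negP => pa.
  have /negP := primeM pu (primeM ps pg); apply.
  by rewrite -e [a * b]mulrC mulrA primeMl.
exists (Defs.frac s pa); rewrite frac_mul frac1.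
by apply: eq_frac_of; ring.
Qed.

(* These ideals stand in for the ideals of [A] in the correspondence with closed
   sets: constant sections already separate closed sets, so the isomorphism
   between [A] and the global sections of its spectrum is not needed. *)
Definition nonunits_on U Z : set (specSections U) :=
  [set s | forall p (Up : pts U p), Z p -> ~ exists r, value s Up * r = 1].
Arguments nonunits_on : clear implicits.

(** The non-units of each local ring [local_at p] form an ideal. *)
Lemma nonunits_on_ideal U Z : ideal_of setT (nonunits_on U Z).
Proof.
split=> // [p Up _ [r]|s t hs ht p Up Zp [r]|s t _ ht p Up Zp [r]].
- have -> : value (0 : specSections U) Up = 0 by [].
  by rewrite mul0r => /esym/eqP; rewrite oner_eq0.
- have -> : value (s - t) Up = value s Up + - value t Up by [].
  move=> /local_at_local[|[r' e]]; first exact: hs.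
  by apply: (ht p Up Zp); exists (- r'); rewrite mulrN -mulNr.
have -> : value (s * t) Up = value s Up * value t Up by [].
move=> e; apply: (ht p Up Zp); exists (value s Up * r).
by rewrite mulrCA mulrA.
Qed.

Lemma closed_zeros Z : closed Z -> exists E, Z = zeros E.
Proof.
by move=> /closed_openC[E ZE]; exists E; rewrite -[LHS]setCK ZE setCK.
Qed.

Lemma noetherian_spectrum U : (forall p, pts U p) ->
  noetherian (specSections U) -> noetherian_space (primeSpec A).
Proof.
move=> UT nU Z clZ decZ.
have [n|n s hs p Up Zp|N hN] := nU (fun n => nonunits_on U (Z n)).
- exact: nonunits_on_ideal.
- by apply: hs; exact: decZ.
exists N => n Nn p ZNp; have [E ZE] := closed_zeros (clZ n).
(* If [a] vanishes on [Z n] but not at [p] in [Z N], the constant section [a] lies in the [n]-th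
   ideal but not in the [N]-th. *)
rewrite ZE => a Ea; apply/negPn/negP => pa.
have : nonunits_on U (Z n) (spec_const U a).
  move=> q Uq; rewrite ZE => /(_ _ Ea) qa /frac_unit.
  by rewrite qa.
by move=> /(hN n Nn) /(_ p (UT p) ZNp); apply; apply/frac_unit.
Qed.

Lemma spectrum_T0 p q : p <> q -> exists W : set (primeSpec A),
  open W /\ (W p /\ ~ W q \/ W q /\ ~ W p).
Proof.
move=> pq; have [a aP] : exists a, (a \in p) <> (a \in q).
  apply/existsNP => h; apply: pq.
  case: p q h => [p ip pp] [q iq pq'] h.
  have e : p = q by apply/funext => a; exact: (h a).
  case: _ / e in iq pq' h *.
  by congr PrimeSpec; exact: Prop_irrelevance.
exists [set r : primeSpec A | a \notin r]; split; first exact: basic_open.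
move=> /=; case: (a \in p) (a \in q) aP => [] [] // _; [right|left]; by split.
Qed.

(** The generic point is the ideal of all elements vanishing on [Z]. It is prime because, if [u * v]
    vanishes on [Z], the zero sets of [u] and [v] cover [Z]. *)
Lemma spectrum_generic_point Z : closed Z -> irreducible_set Z ->
  exists p, generic_point Z p.
Proof.
move=> /closed_zeros[E ->] [[p0 Zp0] irrZ]; set Z0 := zeros E in Zp0 irrZ *.
pose I : A -> bool := fun a => `[< forall p, Z0 p -> a \in p >].
have IP a : reflect (forall p, Z0 p -> a \in p) (a \in (I : {pred A})).
  by apply: (iffP (asboolP _)).
have idI : idealr_closed (I : {pred A}).
  split; first by apply/IP => p _; exact: prime0.
    by apply/negP => /IP /(_ _ Zp0); apply/negP; exact: prime1.
  move=> a u v /IP Iu /IP Iv; apply/IP => p Zp.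
  by apply: primeD; [apply: primeMl; exact: Iu|exact: Iv].
have prI : prime_idealr_closed (I : {pred A}).
  have clV (u : A) : closed [set p : primeSpec A | u \in p].
    rewrite [X in closed X](_ : _ = ~` [set p : primeSpec A | u \notin p]).
      exact/open_closedC/basic_open.
    by apply/seteqP; split=> p /=; [move=> ->|move/negP/negPn].
  move=> u v /IP Iuv; apply/orP.
  have [|h|h] := irrZ _ _ (clV u) (clV v).
  - move=> p Zp /=; have := Iuv p Zp; apply: contraTP => /not_orP[/negP pu /negP pv].
    exact: primeM.
  - by left; apply/IP.
  - by right; apply/IP.
exists (PrimeSpec idI prI); split; first by move=> a Ea; apply/IP => p; exact.
move=> _ [F ->] [p [Fp Zp]] h; apply: Fp => a Fa.
by have /IP := h a Fa; exact.
Qed.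

End Spectrum.

(** * The spectrum of a field *)

Section SpectrumOfField.
Variable k : fieldType.
Implicit Types (p q : primeSpec k).

Lemma prime_field p a : (a \in p) = (a == 0).
Proof.
have [->|a0] := eqVneq a 0; first exact: prime0.
by apply/negP => pa; have := prime1 p; rewrite -(mulVf a0) primeMl.
Qed.

Lemma open_spectrum_field (U : set (primeSpec k)) p q : open U -> U p -> U q.
Proof.
by move=> [E ->] h h'; apply: h => a /h'; rewrite !prime_field.
Qed.

Lemma compact_spectrum_field : compact [set: primeSpec k].
Proof.
move=> F FF _; have [p _] := filter_ex (@filterT _ F _).
exists p; split=> // B C FB; rewrite nbhsE => -[V [oV Vp] VC].
have [q Bq] := filter_ex FB; exists q; split=> //.
exact/VC/(open_spectrum_field _ oV Vp).
Qed.

Lemma sections_field (U : opens (primeSpec k)) p (s : specSections U) :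
  pts U p -> s = 0 \/ exists t, s * t = 1.
Proof.
move=> Up; have [V [a [f [Vp VU hV]]]] := value_frac s Up.
have hV' q (Uq : pts U q) := hV q Uq (open_spectrum_field q (pts_open V) Vp).
have [a0|a0] := eqVneq a 0; [left|right].
  apply: specSectionsP => q Uq; have [qf ->] := hV' q Uq.
  by transitivity (Defs.frac 0 (prime1 q)) => //; apply: eq_frac_of; rewrite a0 !mul0r.
exists (spec_const U (f / a)); apply: specSectionsP => q Uq /=.
have [qf ->] := hV' q Uq; rewrite frac_mul.
by transitivity (Defs.frac 1 (prime1 q)) => //; apply: eq_frac_of; field.
Qed.

End SpectrumOfField.

(** * Schemes and varieties *)

Lemma open_immersion_range_open (X Y : ringedSpace) (j : ringedMap X Y) :
  open_immersion j -> open (range j).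
Proof. by case=> _ oj _; apply: oj; exact: openT. Qed.

Lemma closed_preimage (X Y : ringedSpace) (f : ringedMap X Y) (F : set Y) :
  closed F -> closed (f @^-1` F).
Proof.
move=> /closed_openC oF; rewrite -[_ @^-1` _]setCK preimage_setC.
exact/open_closedC/on_pts_cont.
Qed.

Section Scheme.
Variable X : scheme.

(** An affine chart around [x] separates the points if it misses [y]; otherwise a separating open
    set of the spectrum is pushed forward. *)
Lemma scheme_T0 (x y : X) : x <> y -> exists U : set X,
  open U /\ (U x /\ ~ U y \/ U y /\ ~ U x).
Proof.
move=> xy; have [_ [[A [j [oj <-]]] [p _ px]]] := scheme_affine_nbhs x.
have [[q _ qy]|nqy] := pselect (range j y); last first.
  exists (range j); split; first exact: open_immersion_range_open.
  by left; split=> //; exists p.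
have [|W [oW hW]] := @spectrum_T0 A p q.
  by move=> pq; apply: xy; rewrite -px -qy pq.
case: oj => injj opj _; exists (j @` W); split; first exact: opj.
have jW r : (j @` W) (j r) <-> W r.
  by split=> [[r' Wr' /injj <-]|Wr] //; exists r.
by rewrite -px -qy !jW.
Qed.

Lemma irreducible_preimage (A : comNzRingType)
    (j : ringedMap (spec_ringed A) X) (Z : set X) :
  open_immersion j -> irreducible_set Z -> Z `&` range j !=set0 ->
  irreducible_set (j @^-1` Z).
Proof.
move=> [injj opj _] [_ irrZ] [z [Zz [p _ pz]]]; split; first by exists p; rewrite /= pz.
move=> F G clF clG ZFG.
(* This extends [H] to a closed set of [X]: its image together with everything outside the chart. *)
have clj (H : set (spec_ringed A)) : closed H -> closed (~` (j @` (~` H))).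
  by move=> clH; apply/open_closedC/opj/closed_openC.
have back (H : set (spec_ringed A)) :
    Z `<=` ~` (j @` (~` H)) -> j @^-1` Z `<=` H.
  by move=> ZH q /ZH h; apply: contrapT => nHq; apply: h; exists q.
have [|/back|/back] := irrZ _ _ (clj F clF) (clj G clG); [|by left|by right].
move=> {Zz pz}z Zz; have [[q _ qz]|nq] := pselect (range j z).
  rewrite -qz in Zz *; case: (ZFG q Zz) => Hq; [left|right];
  by move=> [r nr /injj rq]; apply: nr; rewrite rq.
by left=> -[q _ qz]; apply: nq; exists q.
Qed.

Lemma scheme_generic_point (Z : set X) : closed Z -> irreducible_set Z ->
  exists x, generic_point Z x.
Proof.
move=> clZ irrZ; have [[z Zz] irr] := irrZ.
have [_ [[A [j [oj <-]]] jz]] := scheme_affine_nbhs z.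
have [||p [Zp gp]] := @spectrum_generic_point A (j @^-1` Z).
- exact: (closed_preimage (f := j)).
- by apply: irreducible_preimage => //; exists z.
exists (j p); split=> // U oU [y [Uy Zy]].
(* By irreducibility, two open sets that meet [Z] have a common point in [Z]. *)
suff [u [Uu [/= [q _ qu] Zu]]] : U `&` (range j `&` Z) !=set0.
  by apply: (gp (j @^-1` U)); [exact: (@on_pts_cont _ _ j)|exists q; rewrite /= qu].
apply: contrapT => h.
have [|||ZU|Zj] := irr (~` U) (~` range j).
- exact: open_closedC.
- exact/open_closedC/open_immersion_range_open.
- move=> x Zx; apply/not_andP => -[Ux jx]; apply: h; exists x; split=> //.
- exact: ZU Zy Uy.
- exact: Zj Zz jz.
Qed.

End Scheme.

Section Variety.
Variables (k : fieldType) (X : variety k).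

(** The sections over the chart form a finitely generated algebra over a ring whose elements are
    zero or invertible, hence a noetherian ring; [comap j U] carries this to the spectrum. *)
Lemma variety_noetherian_chart (x : X) :
  exists (A : comNzRingType) (j : ringedMap (spec_ringed A) X),
    [/\ open_immersion j, range j x & noetherian_space (primeSpec A)].
Proof.
have [lft _] := variety_finite_type X.
have [U [V [h [Ux [A [j [oj jU]]] _ ft]]]] := lft x.
exists A, j; split=> //; first by rewrite jU.
have nU : noetherian (sections U).
  by apply: finite_type_noetherian ft => a; exact: (sections_field a (h x Ux)).
have UT (p : primeSpec A) : pts (preimO (@on_pts_cont _ _ j) U) p.
  by rewrite /= -jU; exists p.
apply: (noetherian_spectrum UT).
apply: (noetherian_surj (f := comap j U)) => // t.
case: oj => _ _ /(_ U); rewrite jU => /(_ (@subset_refl _ U)) [g _ gK].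
by exists (g t).
Qed.

(** [X] is quasi-compact over the compact spectrum of [k], so the indices at which a chain
    stabilizes on the charts have a common bound. *)
Lemma variety_noetherian_space : noetherian_space X.
Proof.
have [_ /(_ setT openT (@compact_spectrum_field k))] := variety_finite_type X.
rewrite preimage_setT => /compact_near_coveringP cX Z clZ decZ.
have mono m n : (m <= n)%N -> Z n `<=` Z m.
  by move=> mn; apply: (homo_leq (r := fun A B : set X => B `<=` A)) => //
    [A|A B C]; [|move=> AB CA; exact: subset_trans CA AB].
have [|N _ hN] := cX nat \oo (fun N x => forall n, (N <= n)%N -> Z N x -> Z n x).
  move=> x _; have [A [j [oj jx nA]]] := variety_noetherian_chart x.
  have [n|n p|N hN] := nA (fun n => j @^-1` Z n).
  - exact: (closed_preimage (f := j)).
  - exact: decZ.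
  exists (range j, [set n | (N <= n)%N]); first split=> /=.
  - apply: open_nbhs_nbhs; split; [exact: (open_immersion_range_open oj)|exact: jx].
  - by exists N.
  move=> [_ m] /= [[p _ <-] Nm] n mn Zm.
  by apply: (hN n (leq_trans Nm mn)); exact: mono Zm.
by exists N => n Nn x; apply: (hN N (leqnn N)).
Qed.

End Variety.

(** Without a minimal element, choice would build a strictly decreasing sequence of closed sets. *)
Lemma noetherian_minimal_closed (X : topologicalType) (Q : set X -> Prop) :
  noetherian_space X -> (exists Z, closed Z /\ Q Z) ->
  exists Z, [/\ closed Z, Q Z &
    forall Z', closed Z' -> Q Z' -> Z' `<=` Z -> Z `<=` Z'].
Proof.
move=> nX [Z0 Z0P]; apply: contrapT => nomin.
pose T := {Z : set X | closed Z /\ Q Z}.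
have /choice[f fP] : forall Z : T, exists Z' : T,
    sval Z' `<=` sval Z /\ ~ (sval Z `<=` sval Z').
  move=> [Z [clZ QZ]]; apply: contrapT => h; apply: nomin; exists Z; split=> //.
  move=> Z' clZ' QZ' Z'Z; apply: contrapT => ZZ'; apply: h.
  by exists (exist _ Z' (conj clZ' QZ')).
pose s n := iter n f (exist _ Z0 Z0P : T).
have [n|n|N hN] := nX (fun n => sval (s n)).
- by case: (s n) => ? [].
- exact: (fP (s n)).1.
by apply: (fP (s N)).2; exact: (hN N.+1).
Qed.

(** * The constructible topology *)

Section ConstructibleTopology.
Variables (k : fieldType) (X : variety k).
Local Notation T := (abs_space X).

Lemma constructible_abs_open (C : set X) : constructible C -> open (C : set T).
Proof.
move=> cC; exists [set C]; last by rewrite bigcup_set1.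
by move=> _ ->; exact: finI_from1.
Qed.

Lemma abs_cvg (F : set_system T) (x : T) : Filter F ->
  (forall C : set X, constructible C -> C x -> F C) -> F --> x.
Proof.
move=> FF hF B; rewrite nbhsE => -[_ [[D' DD' <-] [S D'S Sx]] OB].
apply: filterS (subset_trans (bigcup_sup D'S) OB) _.
have [D DC SD] := DD' _ D'S; rewrite -SD in Sx *.
apply: filter_bigI => C CD; apply: hF; last exact: Sx.
by have := DC C CD; rewrite inE.
Qed.

Lemma closed_constructible (F : set X) : closed F -> constructible F.
Proof.
by move=> /closed_openC oF; rewrite -[F]setCK; apply/constructibleC/constructible_open.
Qed.

(** A Zariski open set containing just one of the two points and its complement are both open
    here. *)
Lemma abs_hausdorff : hausdorff_space T.
Proof.
rewrite open_hausdorff => x y /eqP /(@scheme_T0 X)[U [oU h]].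
have cU := constructible_abs_open (constructible_open oU).
have cCU := constructible_abs_open (constructibleC (constructible_open oU)).
case: h => [[Ux Uy]|[Uy Ux]]; [exists (U, ~` U)|exists (~` U, U)];
  rewrite ?inE //=; split=> //.
- by rewrite classical_sets.setICr.
- by rewrite classical_sets.setICl.
Qed.

(* An ultrafilter contains a smallest Zariski closed set; that set is
   irreducible and the ultrafilter converges to its generic point. *)
Lemma abs_compact : compact [set: T].
Proof.
rewrite compact_ultra => F FU _.
have [|Z [clZ FZ minZ]] :=
  @noetherian_minimal_closed X F (variety_noetherian_space (X := X)).
  by exists setT; split; [exact: closedT|exact: filterT].
have notF (A : set X) : F A -> ~ F (~` A).
  move=> FA FCA; apply: (@filter_not_empty _ F _).
  by rewrite -(classical_sets.setICr A); exact: filterI.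
have irrZ : irreducible_set Z.
  split; first exact: filter_ex FZ.
  move=> G H clG clH ZGH.
  have [FG|FG] := in_ultra_setVsetC G FU.
    by left=> z Zz; apply: (minZ (Z `&` G) _ _ _ z Zz).2 => //;
      [exact: closedI|exact: filterI].
  right=> z Zz; apply: (minZ (Z `&` H) _ _ _ z Zz).2 => //; first exact: closedI.
  apply: filterS (filterI FZ FG) => y [Zy Gy]; split=> //.
  by case: (ZGH y Zy).
have [x [Zx gx]] := scheme_generic_point clZ irrZ.
exists x; split=> //; apply: abs_cvg => C.
(* An equivalence is needed for the induction, since complements exchange the two implications. *)
suff : constructible C -> F C <-> C x by move=> /[apply] ->.
elim=> {C} [U oU|C _ [FC CF]|C D _ [FC CF] _ [FD DF]].
- split=> [FU'|Ux].
    have [y [Zy Uy]] := filter_ex (filterI FZ FU').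
    by apply: gx => //; exists y.
  have [//|FCU] := in_ultra_setVsetC U FU; exfalso.
  suff h : Z `<=` Z `&` ~` U by case: (h x Zx).
  apply: minZ => //; last exact: filterI.
  by apply: closedI => //; exact: open_closedC.
- split=> [FCC Cx|nCx]; first exact: (notF C (CF Cx)).
  by have [/FC|] := in_ultra_setVsetC C FU.
- split=> [FCD|[/CF FC' /DF FD']]; last exact: filterI.
  by split; [apply: FC|apply: FD]; apply: filterS FCD => y [].
Qed.

End ConstructibleTopology.

(** * Radon measures *)

Lemma countableU (U : Type) (A B : set U) :
  countable A -> countable B -> countable (A `|` B).
Proof.
move=> cA cB; rewrite -bigcup2E.
by apply: bigcup_countable => [|[|[]]] //=.
Qed.

Section Atomic.
Variables (R : realType) (k : fieldType) (X : variety k).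
Variable mu : {measure set (borel (abs_space X)) -> \bar R}.
Hypothesis hmu : radon mu.
Local Notation T := (abs_space X).

Lemma open_measurable_borel (U : set T) :
  open U -> measurable (U : set (borel T)).
Proof. by move=> oU; apply: sub_sigma_algebra. Qed.

Lemma closed_measurable_borel (F : set T) :
  closed F -> measurable (F : set (borel T)).
Proof.
move=> /closed_openC /open_measurable_borel mF.
by rewrite -[F]setCK; exact: measurableC mF.
Qed.

Lemma zariski_closed_measurable (F : set X) :
  closed F -> measurable (F : set (borel T)).
Proof.
by move=> /closed_constructible /constructible_abs_open /open_measurable_borel.
Qed.

Lemma closed_point (x : T) : closed [set x].
Proof. exact/accessible_closed_set1/hausdorff_accessible/abs_hausdorff. Qed.

Lemma countable_measurable_borel (C : set T) :
  countable C -> measurable (C : set (borel T)).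
Proof.
apply: (@countable_measurable _ (borel T)) => x.
exact: (closed_measurable_borel (@closed_point x)).
Qed.

Lemma radon_lty (B : set (borel T)) : measurable B -> (mu B < +oo)%E.
Proof.
move=> mB; case: hmu => /(_ _ (@abs_compact _ X)) h _ _.
by apply: le_lt_trans h; apply: le_measure => //; rewrite inE.
Qed.

(* A compact subset of [Z] missing the generic point lies in a proper Zariski
   closed subset of [Z], because [Z] minus its generic point is the directed
   union of these, and they are open for the constructible topology. *)
Lemma compact_off_generic_point (Z : set X) (x : X) (K : set T) :
  closed Z -> generic_point Z x -> compact K -> K `<=` Z `\ x ->
  exists W : set X, [/\ closed W, W `<=` Z `\ x & K `<=` W].
Proof.
move=> clZ [Zx gx] /compact_near_coveringP cK KZ.
pose D := [set W : set X | closed W /\ W `<=` Z `\ x].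
(* The filter of large members of [D], directed by unions; compactness along it yields one member
   containing all of [K]. *)
have FD : Filter (filter_from D (fun W => [set W' : set X | D W' /\ W `<=` W'])).
  apply: filter_from_filter.
    by exists set0; split; [exact: closed0|].
  move=> V W [clV VZ] [clW WZ]; exists (V `|` W).
    by split; [exact: closedU|move=> y []; [exact: VZ|exact: WZ]].
  by move=> W' [DW' VW]; split; split=> // y hy; apply: VW; [left|right].
have [|W DW h] := cK _ _ (fun (W' : set X) y => D W' /\ W' y) FD.
  move=> y /KZ[Zy yx].
  have [U [oU Uxy]] := @scheme_T0 X y x yx.
  (* An open set containing [y] meets [Z], hence contains its generic point [x]. *)
  have [Ux nUy] : U x /\ ~ U y.
    by case: Uxy => [[Uy nUx]|//]; case: nUx; apply: gx => //; exists y.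
  have DW : D (Z `&` ~` U).
    split; first by apply: closedI => //; exact: open_closedC.
    by move=> z [Zz nUz]; split=> // zx; apply: nUz; rewrite zx.
  exists ((Z `&` ~` U : set T), [set W' | D W' /\ Z `&` ~` U `<=` W']); last first.
    by move=> [z W'] /= [Wz [DW' WW']]; split=> //; exact: WW'.
  split=> /=; last by exists (Z `&` ~` U).
  apply: open_nbhs_nbhs; split=> //.
  by apply: constructible_abs_open; apply: closed_constructible; case: DW.
have KW y : K y -> W y by move=> Ky; case: (h W _ y Ky) => //; split.
by case: DW => clW WZ; exists W; split.
Qed.

Lemma countable_carrier (Z0 : set X) : closed Z0 ->
  exists C : set T, countable C /\ mu.-negligible (Z0 `\` C).
Proof.
move=> clZ0; apply: contrapT => nZ0.
pose atomic (Z : set X) :=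
  exists C : set T, countable C /\ mu.-negligible (Z `\` C).
(* [Z] is a minimal counterexample, so proper closed subsets of [Z] have countable carriers. *)
have [|Z [clZ nZ minZ]] := @noetherian_minimal_closed X (fun Z => ~ atomic Z)
  (variety_noetherian_space (X := X)); first by exists Z0.
have proper W : closed W -> W `<=` Z -> ~ (Z `<=` W) -> atomic W.
  by move=> clW WZ ZW; apply: contrapT => nW; exact: (ZW (minZ _ clW nW WZ)).
apply: nZ; have [Zset0|Zn0] := pselect (Z = set0).
  by exists set0; split=> //; rewrite Zset0 set0D; exact: negligible_set0.
(* A reducible nonempty [Z] is the union of two proper closed subsets, whose carriers are joined. *)
have [irrZ|] := pselect (irreducible_set Z); last first.
  move=> nirr; have [F [G [clF clG ZFG nF nG]]] : exists F G : set X,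
      [/\ closed F, closed G, Z `<=` F `|` G, ~ (Z `<=` F) & ~ (Z `<=` G)].
    apply: contrapT => h; apply: nirr; split; first exact/set0P/eqP.
    move=> F G clF clG ZFG; apply: contrapT => /not_orP[nF nG].
    by apply: h; exists F, G.
  have sub (H : set X) : closed H -> ~ (Z `<=` H) -> atomic (Z `&` H).
    move=> clH nH; apply: proper; [exact: closedI|exact: subIsetl|].
    by move=> ZH; apply: nH => z /ZH[].
  have [C [cC nC]] := sub F clF nF; have [D [cD nD]] := sub G clG nG.
  exists (C `|` D); split; first exact: countableU.
  apply: negligibleS (negligibleU nC nD) => z [Zz /not_orP[Cz Dz]].
  by case: (ZFG z Zz) => Hz; [left|right].
have [x gx] := scheme_generic_point clZ irrZ.
pose Y : set (borel T) := Z `\ x.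
have oY : open (Y : set T).
  apply: openI; first exact/constructible_abs_open/closed_constructible.
  exact/closed_openC/closed_point.
have mY := open_measurable_borel oY.
have Yfin := radon_lty mY.
have /choice[W hW] : forall n : nat, exists W : set X,
    [/\ closed W, W `<=` Y & (mu Y - n.+1%:R^-1%:E < mu W)%E].
  move=> n; case: hmu => _ _ /(_ _ oY) muY.
  have n0 : 0 < n.+1%:R^-1 :> R by rewrite invr_gt0.
  have [|_ [K [cK KY] <-] ltK] := @ub_ereal_sup_adherent R
    [set mu K | K in [set K : set T | compact K /\ K `<=` Y]] _ n0.
    by rewrite -muY ge0_fin_numE.
  rewrite -muY in ltK.
  have [W [clW WY KW]] := compact_off_generic_point clZ gx cK KY.
  exists W; split=> //; apply: lt_le_trans ltK _.
  apply: le_measure => //; rewrite inE; last exact: zariski_closed_measurable.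
  by apply: closed_measurable_borel; apply: compact_closed cK; exact: abs_hausdorff.
have /choice[C hC] : forall n, exists C : set T,
    countable C /\ mu.-negligible (W n `\` C).
  (* [W n] is proper in [Z] because it misses the generic point. *)
  move=> n; have [clW WY _] := hW n; apply: proper => //.
    by move=> y /WY[].
  by move=> /(_ x gx.1) /WY[_]; apply.
have mW n : measurable (W n : set (borel T)).
  have [clW _ _] := hW n.
  exact: zariski_closed_measurable.
pose V : set (borel T) := \bigcup_n W n.
have VY : V `<=` Y by apply: bigcup_sub => n _; case: (hW n).
have mV : measurable V by apply: bigcup_measurable => n _; exact: mW.
have YV0 : mu (Y `\` V) = 0%E.
  have -> : mu (Y `\` V) = (mu Y - mu V)%E by rewrite measureD// setIidr.
  suff -> : mu V = mu Y by rewrite subee// ge0_fin_numE.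
  apply/eqP; rewrite eq_le; apply/andP; split.
    by apply: le_measure; rewrite ?inE.
  (* [mu Y] exceeds [mu V] by less than every [1 / (n + 1)], since [V] contains [W n]. *)
  apply/lee_addgt0Pr => _/posnumP[e].
  have [n _ /(_ n (leqnn n)) ne] := near_infty_natSinv_lt e.
  have [_ _] := hW n; rewrite lteBlDr// => /ltW/le_trans; apply.
  apply: leeD; last by rewrite lee_fin ltW.
  by apply: le_measure; rewrite ?inE//; exact: bigcup_sup.
have YV : mu.-negligible (Y `\` V).
  by apply/negligibleP; first exact: measurableD.
exists ([set x] `|` \bigcup_n C n); split.
  by apply: countableU => //; apply: bigcup_countable => // n _; case: (hC n).
apply: negligibleS (negligibleU YV (negligible_bigcup (fun n => (hC n).2))).
move=> z [Zz /not_orP[zx nC]].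
have [[n _ Wz]|nW] := pselect (V z).
  by right; exists n => //; split=> // Cz; apply: nC; exists n.
by left; split.
Qed.

End Atomic.

(** * Decomposition of the measure into atoms *)

Theorem theorem1p12 (R : realType) (k : closedFieldType) (X : variety k)
    (mu : {measure set (borel (abs_space X)) -> \bar R}) (hmu : radon mu) :
  exists (a : nat -> R) (x : nat -> borel (abs_space X)),
    (forall i, 0 <= a i) /\
    forall B : set (borel (abs_space X)), measurable B ->
      mu B = (\sum_(0 <= i <oo) ((a i)%:E * \d_(x i) B))%E.
Proof.
have [C [cC negC]] := countable_carrier hmu (@closedT X).
have /countable_injP[f injf] := cC.
(* As [f] is injective on [C], each [S n] is empty or a single point. *)
pose S n : set (borel (abs_space X)) := C `&` [set y | f y = n].
have mS n : measurable (S n).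
  apply: countable_measurable_borel; apply: sub_countable cC.
  by apply: subset_card_le => y [].
have finS n : mu (S n) \is a fin_num by rewrite ge0_fin_numE// radon_lty.
(* When [S n] is empty, [get] returns a default point, but its coefficient is 0. *)
exists (fun n => fine (mu (S n))), (fun n => get (S n)); split=> [n|B mB].
  by rewrite fine_ge0.
have mC : measurable (C : set (borel (abs_space X))).
  exact: countable_measurable_borel.
have -> : mu B = mu (\bigcup_n (B `&` S n)).
  rewrite -setI_bigcupr; have -> : \bigcup_n S n = C.
    by apply/seteqP; split=> [y [n _ []]//|y Cy]; exists (f y).
  (* The part of [B] outside the carrier [C] is null. *)
  rewrite -[in LHS](setUIDK B C) measureU0 //.
  - exact: measurableI.
  - exact: measurableD.
  - apply: measure_negligible; first exact: measurableD.
    by apply: negligibleS negC => y [_ nCy]; split.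
rewrite measure_bigcup; last 2 first.
- by move=> n _; exact: measurableI.
- by move=> m n _ _ [y [[_ [_ <-]] [_ [_ <-]]]].
rewrite (eq_eseriesl (Q := xpredT)); last by move=> n; rewrite in_setT.
apply: eq_eseriesr => n _; rewrite fineK// diracE.
have [->|/set0P[y Sy]] := eqVneq (S n) set0.
  by rewrite setI0 measure0 mul0e.
have Sn z : S n z -> z = y.
  case: Sy => [Cy fy] [Cz fz]; apply: injf; rewrite ?inE//.
  by rewrite fz fy.
have -> : get (S n) = y by apply: Sn; exact: getI Sy.
have [By|nBy] := boolP (y \in B).
  by rewrite mule1; congr (mu _); apply/setIidr => z /Sn ->; rewrite inE in By.
rewrite mule0 (_ : _ `&` _ = set0) ?measure0//.
by apply/seteqP; split=> // z [Bz /Sn zy]; rewrite -zy mem_set in nBy.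
Qed.
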